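(* Let $t \ge 4$ be an integer and let $G$ be a $t$-tough graph on $n \ge 3$ vertices with (non-decreasing) degree sequence $d_1, d_2, \dots, d_n$. Suppose that for all positive integers $i < \frac{n}{2}$, $d_i \le i$ implies $d_{n-i+t} \ge n-i$. Then $G$ is Hamiltonian.
   Context: Graphs are simple, undirected and finite. A non-decreasing sequence $d_1 \le d_2 \le \dots \le d_n$ is a degree sequence of a graph $G$ if the vertices of $G$ can be labeled $v_1, \dots, v_n$ such that $\deg(v_i) = d_i$ for all $i$. Let $c(H)$ denote the number of components of a graph $H$. For a real number $t \ge 0$, $G$ is $t$-tough if $|S| \ge t \cdot c(G-S)$ for all $S \subseteq V(G)$ with $c(G-S) \ge 2$ (so complete graphs are $t$-tough for every $t$). A graph is Hamiltonian if it has a cycle containing all its vertices. (For the $t$-tough graphs considered here, $d_i \le i$ with $i < n/2$ can only occur when $i \ge t$, so the index $n-i+t$ is at most $n$ whenever it is used.) *)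

(* Defs.v *)
From mathcomp Require Import all_boot.

Set Implicit Arguments.
Unset Strict Implicit.
Unset Printing Implicit Defensive.

(* A simple graph is a symmetric irreflexive adjacency relation on a finType. *)
Definition simple_graph (T : finType) (e : rel T) : Prop :=
  symmetric e /\ irreflexive e.

Definition degree (T : finType) (e : rel T) (x : T) : nat := #|[set y | e x y]|.

(* The vertices of S stay in the carrier as isolated points and are discarded
   when components are counted. *)
Definition delete_rel (T : finType) (e : rel T) (S : {set T}) : rel T :=
  [rel x y | [&& x \notin S, y \notin S & e x y]].

(* c(G - S) *)
Definition components_del (T : finType) (e : rel T) (S : {set T}) : nat :=
  n_comp (delete_rel e S) (~: S).

(* t-toughness for integer t >= 0, which keeps the inequality in nat. *)
Definition tough (T : finType) (e : rel T) (t : nat) : Prop :=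
  forall S : {set T},
    2 <= components_del e S -> t * components_del e S <= #|S|.

(* The bijectivity of the labelling v forces size d = #|T|. *)
Definition degree_sequence (T : finType) (e : rel T) (d : seq nat) : Prop :=
  sorted leq d /\
  exists v : 'I_(size d) -> T,
    bijective v /\ forall i : 'I_(size d), degree e (v i) = nth 0 d i.

(* 1-based indexing d_i, meaningful for 1 <= i <= size d. *)
Definition dterm (d : seq nat) (i : nat) : nat := nth 0 d i.-1.

Definition hamiltonian (T : finType) (e : rel T) : Prop :=
  exists c : seq T,
    [/\ 3 <= size c, ucycle e c & forall x : T, x \in c].

(* Main.v *)
Require Import Defs.
From mathcomp Require Import all_boot.
From mathcomp Require Import zify.

Set Implicit Arguments.
Unset Strict Implicit.
Unset Printing Implicit Defensive.

(* Adding edges preserves toughness and the degree condition. So it suffices to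
   show (1) that for nonadjacent x, y with deg x + deg y >= n - t, G is Hamiltonian
   as soon as G + xy is, and (2) that a graph satisfying the hypotheses in which
   no such pair is left is complete.

   For (1), let v_0 = x, ..., v_m = y be a Hamiltonian path of G and suppose that
   G is not Hamiltonian. A predecessor of a neighbour of x is then never a
   neighbour of y, and since the degree sum is large, all but at most t vertices
   are predecessors of neighbours of x or successors of neighbours of y. Rerouting
   the path along chords shows, together with toughness, that these two classes
   are disjoint and that few vertices cover all edges between them; this gives a
   cut of fewer than 2t vertices. *)

(** * Toughness through colourings *)

Definition nbrs (T : finType) (e : rel T) (x : T) : {set T} := [set y | e x y].

(* A colouring of G - S that is constant along edges has at most c(G - S)
   colours; in this form toughness visibly survives the addition of edges. *)
Definition tough_col (T : finType) (e : rel T) (t : nat) : Prop :=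
  forall (rT : finType) (S : {set T}) (f : T -> rT),
    (forall x y, x \notin S -> y \notin S -> e x y -> f x = f y) ->
    2 <= #|f @: ~: S| -> t * #|f @: ~: S| <= #|S|.

Lemma tough_tough_col (T : finType) (e : rel T) (t : nat) :
  symmetric e -> tough e t -> tough_col e t.
Proof.
move=> e_sym e_tough rT S f f_const im_ge2.
have del_sym : symmetric (delete_rel e S).
  by move=> x y; rewrite /delete_rel /= e_sym andbCA.
have f_connect x y : connect (delete_rel e S) x y -> f x = f y.
  case/connectP=> p; elim: p x => [|z p IHp] x /= => [_ -> //|].
  by case/andP=> /and3P[xS zS exz] /IHp IH /IH <-; apply: f_const.
have root_notS x : x \notin S -> root (delete_rel e S) x \notin S.
  case/connectP: (connect_root (delete_rel e S) x) => p + ->.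
  elim: p x => [|z p IHp] x //= /andP[/and3P[_ zS _] zp] _.
  exact: IHp.
have im_le : #|f @: ~: S| <= components_del e S.
  rewrite /components_del /n_comp_mem.
  apply: leq_trans (leq_imset_card f _); apply: subset_leq_card.
  apply/subsetP=> _ /imsetP[x xS ->]; apply/imsetP.
  exists (root (delete_rel e S) x); last exact/f_connect/connect_root.
  rewrite in_setC in xS.
  by rewrite !inE root_notS // andbT; apply/roots_root/sym_connect_sym.
apply: leq_trans (e_tough S (leq_trans im_ge2 im_le)).
by rewrite leq_mul2l im_le orbT.
Qed.

Lemma tough_col_sub (T : finType) (e e' : rel T) (t : nat) :
  subrel e e' -> tough_col e t -> tough_col e' t.
Proof.
move=> ee' e_tough rT S f f_const; apply: e_tough => x y xS yS /ee'.
exact: f_const.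
Qed.

Section Tough.
Variables (T : finType) (e : rel T) (t : nat).
Hypothesis e_tough : tough_col e t.

(** Membership in [A] is a colouring that takes both values outside [S]. *)
Lemma tough_separator (S A : {set T}) (x y : T) :
  x \notin S -> x \in A -> y \notin S -> y \notin A ->
  (forall u v, u \notin S -> v \notin S -> e u v -> (u \in A) = (v \in A)) ->
  2 * t <= #|S|.
Proof.
move=> xS xA yS yA A_const; set f := fun u => u \in A.
have im_f : 2 <= #|f @: ~: S|.
  have <- : #|[set true; false]| = 2 by rewrite cards2.
  apply/subset_leq_card/subsetP=> b.
  rewrite !inE => /orP[] /eqP->; apply/imsetP.
    by exists x; rewrite ?inE.
  by exists y; rewrite ?inE // /f (negbTE yA).
apply: leq_trans (e_tough A_const im_f).
by rewrite mulnC leq_mul2l im_f orbT.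
Qed.

(** The neighbourhood of [x] cuts [x] off from [y]. *)
Lemma tough_degree (x y : T) :
  symmetric e -> irreflexive e -> x != y -> ~~ e x y -> 2 * t <= degree e x.
Proof.
move=> e_sym e_irr xy exy.
apply: (@tough_separator [set u | e x u] [set x] x y);
  rewrite ?inE ?e_irr // 1?eq_sym // => u v.
rewrite !inE => exu exv euv; case: eqP => [ux|_].
  by rewrite -ux euv in exv.
by case: eqP => // vx; rewrite -vx e_sym euv in exu.
Qed.

Lemma tough_indep (I N : {set T}) :
  2 <= #|I| -> [disjoint I & N] ->
  (forall x y, x \in I -> e x y -> y \in N) -> symmetric e ->
  t * #|I| <= #|N|.
Proof.
(* Deleting [N] isolates each vertex of [I], so each can have its own colour; all other vertices
   share [None]. *)
move=> I_ge2 IN nbrI e_sym; set f := fun x => if x \in I then Some x else None.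
have im_f : #|I| <= #|f @: ~: N|.
  rewrite -(card_imset I (@Some_inj _)); apply/subset_leq_card/subsetP.
  move=> _ /imsetP[x xI ->]; apply/imsetP; exists x.
    by rewrite inE (disjointFr IN).
  by rewrite /f xI.
apply: leq_trans (e_tough _ (leq_trans I_ge2 im_f)); first exact: leq_mul.
move=> x y xN yN exy; rewrite /f; case: ifP => [xI|_].
  by rewrite (nbrI x y) in yN.
by case: ifP => // yI; rewrite (nbrI y x) // e_sym in xN.
Qed.
End Tough.

(** * Degree-closed graphs *)

(* The hypothesis on the degree sequence, phrased by counting vertices so that
   adding edges visibly preserves it. *)
Definition degree_condition (T : finType) (e : rel T) (t : nat) : Prop :=
  forall i, 0 < i -> 2 * i < #|T| -> i <= #|[set x | degree e x <= i]| ->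
    i < #|[set x | #|T| - i <= degree e x]| + t.

Lemma degree_sub (T : finType) (e e' : rel T) (x : T) :
  subrel e e' -> degree e x <= degree e' x.
Proof.
move=> ee'; apply/subset_leq_card/subsetP=> y; rewrite !inE; exact: ee'.
Qed.

Lemma degree_condition_sub (T : finType) (e e' : rel T) (t : nat) :
  subrel e e' -> degree_condition e t -> degree_condition e' t.
Proof.
move=> ee' cond i i0 i_n small.
have := cond i i0 i_n; move/(_ _)/leq_trans; apply.
  apply: leq_trans small _; apply/subset_leq_card/subsetP=> x; rewrite !inE.
  exact/leq_trans/degree_sub.
rewrite leq_add2r; apply/subset_leq_card/subsetP=> x; rewrite !inE => /leq_trans.
by apply; apply: degree_sub.
Qed.

Lemma card_bigcup_leq (I T : finType) (A : {set I}) (F : I -> {set T}) :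
  #|\bigcup_(i in A) F i| <= \sum_(i in A) #|F i|.
Proof.
elim/big_rec2: _ => [|i m B _ IH]; first by rewrite cards0.
by apply: leq_trans (leq_card_setU _ _).1 _; rewrite leq_add2l.
Qed.

Section DegreeClosed.
Variables (T : finType) (e : rel T) (t : nat).
Hypotheses (e_sym : symmetric e) (e_irr : irreflexive e).
Hypotheses (t_ge2 : 2 <= t) (e_tough : tough_col e t).
Hypothesis e_cond : degree_condition e t.
Hypothesis e_closed : forall x y, x != y -> ~~ e x y ->
  degree e x + degree e y + t < #|T|.

Lemma small_degree_card (y : T) (a : nat) :
  (forall w, w != y -> ~~ e y w -> degree e w <= a) ->
  #|T| <= #|[set w | degree e w <= a]| + degree e y + 1.
Proof.
move=> le_a; rewrite -addnA -cardsT addnC -(cards1 y).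
apply: leq_trans (leq_add (leq_card_setU [set w | e y w] [set y]).1 (leqnn _)).
apply: leq_trans (leq_card_setU _ _).1.
apply/subset_leq_card/subsetP=> w _; rewrite !inE.
case: eqP => [|/eqP wy]; rewrite ?orbT ?orbF //.
by case: (boolP (e y w)) => //= ?; rewrite le_a.
Qed.

(** Otherwise the degree condition applies at [degree e w + t]: closedness bounds the degree of [u],
    so enough vertices have degree at most [degree e w]. The condition then yields more than
    [degree e w] vertices of large degree, all adjacent to [w] by closedness. *)
Lemma max_nonneighbour_degree (u w : T) :
  w != u -> ~~ e u w ->
  (forall w', w' != u -> ~~ e u w' -> degree e w' <= degree e w) ->
  #|T| <= 2 * (degree e w + t).
Proof.
move=> wu euw w_max; rewrite leqNgt; apply/negP=> big.
have := small_degree_card w_max.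
have wu_lt := e_closed wu (contraNN (fun H => etrans (e_sym u w) H) euw).
set a := degree e w in wu_lt big * => card_a.
have a_small : a + t <= #|[set x | degree e x <= a + t]|.
  apply: (@leq_trans #|[set x | degree e x <= a]|); first by lia.
  apply/subset_leq_card/subsetP=> x; rewrite !inE; lia.
have := @e_cond (a + t) ltac:(lia) big a_small.
rewrite ltn_add2r ltnNge => /negP; apply.
apply/subset_leq_card/subsetP=> x; rewrite !inE => x_big.
apply: contraTT x_big => ewx; rewrite -ltnNge.
have [->|xw] := eqVneq x w; first by rewrite -/a; lia.
have := e_closed xw; rewrite e_sym => /(_ ewx); rewrite -/a; lia.
Qed.

Lemma maximal_indep (W : {set T}) : exists I : {set T},
  [/\ I \subset W, {in I &, forall x y, ~~ e x y} &
      forall x, x \in W -> x \notin I -> exists2 y, y \in I & e y x].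
Proof.
pose P (I : {set T}) :=
  (I \subset W) && [forall x in I, forall y in I, ~~ e x y].
have [|I /maxsetP[/andP[IW /'forall_in_forall_inP I_ind] I_max] _] :=
    @maxset_exists _ P set0.
  by rewrite /P sub0set; apply/'forall_in_forall_inP=> x; rewrite inE.
exists I; split=> [|x y xI yI|x xW xI]; [by []|exact: I_ind|].
case: (pickP [pred y in I | e y x]) => [y /andP[yI eyx] | noI]; first by exists y.
have Ix y : y \in I -> ~~ e y x.
  by move=> yI; apply/negbT; rewrite -(noI y) /= yI.
case/negP: xI.
rewrite -[I](I_max (x |: I)) ?setU11 ?subsetUr //.
rewrite /P subUset sub1set xW IW; apply/'forall_in_forall_inP=> y.
rewrite !inE => /orP[/eqP->|yI] z; rewrite !inE => /orP[/eqP->|zI].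
- by rewrite e_irr.
- by rewrite e_sym Ix.
- by rewrite Ix.
- exact: I_ind.
Qed.

(* Among nonadjacent pairs take x, y with the largest degree sum, deg x <= deg y.
   At least deg x + t vertices W have degree at most deg x, while the degree
   condition at K, the largest integer below n/2, yields more than K - t vertices
   U, all of which turn out to be universal. So vertices of W have few neighbours
   outside U, and a maximal independent subset of W is large compared with its
   neighbourhood, against toughness. *)
Lemma degree_closed_complete (x y : T) : 3 <= #|T| -> x != y -> e x y.
Proof.
move=> n_ge3 xy0; apply: contraT => exy0.
pose P := [pred p : T * T | (p.1 != p.2) && ~~ e p.1 p.2].
have P0 : P (x, y) by rewrite /= xy0.
case: (arg_maxnP (fun p => degree e p.1 + degree e p.2) P0) => {P0 xy0 exy0}.
case=> {}x {}y /= /andP[xy exy] xy_max0.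
have {xy_max0} xy_max u w : u != w -> ~~ e u w ->
    degree e u + degree e w <= degree e x + degree e y.
  by move=> uw euw; apply: (xy_max0 (u, w)); rewrite /= uw.
wlog le_xy : x y xy exy xy_max / degree e x <= degree e y.
  move=> IH; case: (leqP (degree e x) (degree e y)) => [|/ltnW] le.
    exact: (IH x y).
  apply: (IH y x); rewrite ?(eq_sym y) ?(e_sym y) // => u w uw euw.
  by rewrite (addnC (degree e y)) xy_max.
have xy_lt := e_closed xy exy.
have y_max w : w != y -> ~~ e y w -> degree e w <= degree e x.
  move=> wy eyw; have := xy_max w y wy; rewrite e_sym => /(_ eyw).
  by rewrite leq_add2r.
have eyx : ~~ e y x by rewrite e_sym.
have n_le := max_nonneighbour_degree xy eyx y_max.
have W_card := small_degree_card y_max.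
set a := degree e x in y_max n_le W_card xy_lt le_xy.
set W := [set w | degree e w <= a] in W_card.
pose K := #|T|.-1./2; pose U := [set u | #|T| - K <= degree e u].
(* [W] has at least [a + t >= K] members by [n_le], and [a <= K] because [2 * a + t < #|T|]. *)
have U_card : K < #|U| + t.
  apply: e_cond; rewrite /K; try by lia.
  apply: (@leq_trans #|W|); first by lia.
  apply/subset_leq_card/subsetP=> w; rewrite !inE; lia.
(* Otherwise a nonneighbour of [u] of largest degree [b] has [b + t < K], against
   [max_nonneighbour_degree]. *)
have U_univ u w : u \in U -> w != u -> e u w.
  rewrite inE => uU wu; apply: contraT => euw.
  pose Q := [pred w | (w != u) && ~~ e u w].
  have Qw : Q w by rewrite /= wu.
  case: (arg_maxnP (degree e) Qw) => {wu euw Qw} /= {}w /andP[wu euw] w_max.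
  have := @max_nonneighbour_degree u w wu euw.
  have := e_closed wu; rewrite e_sym => /(_ euw) lt.
  suff w_max' : forall w', w' != u -> ~~ e u w' -> degree e w' <= degree e w.
    by move=> /(_ w_max'); move: uU; rewrite /K; lia.
  by move=> w' w'u euw'; apply: w_max; rewrite w'u.
have WU w : w \in W -> w \notin U by rewrite !inE /K; lia.
have WU_deg w : w \in W -> #|U| + #|nbrs e w :\: U| <= a.
  move=> wW; apply: (@leq_trans (degree e w)); last by rewrite inE in wW.
  rewrite /degree -/(nbrs e w) -(cardsID U (nbrs e w)) leq_add2r.
  apply/subset_leq_card/subsetP=> u uU; rewrite !inE in uU *; rewrite uU andbT.
  by rewrite e_sym U_univ ?inE //; apply: contraL wW => /eqP->; rewrite inE; lia.
have [I [/subsetP IW I_ind I_max]] := maximal_indep W.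
pose s := a - #|U|.
have U_le : #|U| <= a.
  by apply: leq_trans (leq_addr _ _) (WU_deg x _); rewrite inE.
have nbr_le w : w \in W -> #|nbrs e w :\: U| <= s by move/WU_deg; rewrite /s; lia.
have W_le : #|W| <= #|I| * s.+1.
  apply: (@leq_trans (\sum_(i in I) #|i |: (nbrs e i :\: U)|)); last first.
    rewrite -sum_nat_const; apply: leq_sum => i iI.
    by rewrite cardsU1; have := nbr_le i (IW i iI); case: (_ \notin _); lia.
  apply: leq_trans (card_bigcup_leq _ _); apply/subset_leq_card/subsetP=> w wW.
  apply/bigcupP; have [wI|wI] := boolP (w \in I).
    by exists w; rewrite ?setU11.
  have [i iI eiw] := I_max w wW wI.
  by exists i; rewrite // in_setU in_setD WU // [w \in nbrs e i]inE eiw orbT.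
have N_le : #|U :|: \bigcup_(i in I) (nbrs e i :\: U)| <= #|U| + #|I| * s.
  apply: leq_trans (leq_card_setU _ _).1 _; rewrite leq_add2l.
  apply: leq_trans (card_bigcup_leq _ _) _.
  rewrite -sum_nat_const; apply: leq_sum => i iI; exact/nbr_le/IW.
have I_ge2 : 2 <= #|I|.
  by case: #|I| W_le => [|[|//]]; rewrite ?mul0n ?mul1n /s; lia.
have tI_le : t * #|I| <= #|U| + #|I| * s.
  apply: leq_trans (tough_indep e_tough I_ge2 _ _ e_sym) N_le.
    rewrite disjoints_subset; apply/subsetP=> w wI; rewrite in_setC in_setU negb_or.
    rewrite WU ?IW //=; apply/bigcupP=> -[i iI].
    rewrite in_setD [w \in nbrs e i]inE => /andP[_].
    by apply/negP; apply: I_ind.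
  move=> w z wI ewz; rewrite inE; case: (boolP (z \in U)) => //= zU.
  by apply/bigcupP; exists w; rewrite // in_setD zU [z \in nbrs e w]inE.
(* From [2 * a + t < #|T| <= 2 * K + 2] and [K < #|U| + t]. *)
have s_le : 2 * s + 1 <= t by rewrite /s; move: U_card; rewrite /K; lia.
have : (2 * s + 1) * #|I| <= t * #|I| by rewrite leq_mul2r s_le orbT.
(* Now [#|I| * s.+1 <= #|U| <= a], whereas [W_le] bounds the left side below by [#|W| >= a + t]. *)
nia.
Qed.
End DegreeClosed.

(** * Rerouting a Hamiltonian path *)

Section HamiltonianPath.
Variables (T : finType) (e : rel T) (v : nat -> T) (m : nat).
Hypothesis e_sym : symmetric e.
Hypothesis m_ge2 : 2 <= m.
Hypothesis v_inj : forall i j, i <= m -> j <= m -> v i = v j -> i = j.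
Hypothesis v_surj : forall u, exists2 i, i <= m & v i = u.
Hypothesis v_path : forall i, i < m -> e (v i) (v i.+1).

(* The stretch of the path from [v p.1] to [v p.2], traversed backwards when
   [p.2 < p.1]. *)
Definition piece (p : nat * nat) : seq T :=
  if p.1 <= p.2 then map v (iota p.1 (p.2.+1 - p.1))
  else rev (map v (iota p.2 (p.1.+1 - p.2))).

Definition in_piece (k : nat) (p : nat * nat) : bool :=
  minn p.1 p.2 <= k <= maxn p.1 p.2.

Definition trail (s : seq T) (x y : T) : Prop :=
  exists p, [/\ s = x :: p, path e x p & last x p = y].

Lemma trail_cat (s1 s2 : seq T) (x1 y1 x2 y2 : T) :
  trail s1 x1 y1 -> e y1 x2 -> trail s2 x2 y2 -> trail (s1 ++ s2) x1 y2.
Proof.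
move=> [p1 [-> path1 <-]] e12 [p2 [-> path2 <-]].
by exists (p1 ++ x2 :: p2); rewrite cat_path path1 /= e12 last_cat.
Qed.

Lemma trail_rev (s : seq T) (x y : T) : trail s x y -> trail (rev s) y x.
Proof.
move=> [p [-> xp <-]]; exists (rev (belast x p)).
split; first by rewrite lastI rev_rcons.
  by rewrite rev_path; rewrite (eq_path (e' := e)) // => u w; rewrite e_sym.
by case: p {xp} => //= z p; rewrite rev_cons last_rcons.
Qed.

Lemma trail_up (i n : nat) : i + n <= m ->
  trail (map v (iota i n.+1)) (v i) (v (i + n)).
Proof.
elim: n i => [|n IHn] i; first by exists [::]; rewrite addn0.
rewrite addnS => lt; rewrite -addSn in lt *.
apply: (@trail_cat [:: v i] _ _ (v i)); last exact: IHn.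
  by exists [::].
by apply: v_path; lia.
Qed.

Lemma trail_piece (p : nat * nat) : p.1 <= m -> p.2 <= m ->
  trail (piece p) (v p.1) (v p.2).
Proof.
case: p => i j /= i_m j_m; rewrite /piece /=; case: (leqP i j) => ij.
  by rewrite subSn //; have := @trail_up i (j - i); rewrite subnKC //; apply.
apply: trail_rev; rewrite subSn; last by lia.
by have := @trail_up j (i - j); rewrite subnKC; [apply | lia].
Qed.

Lemma mem_piece (p : nat * nat) (k : nat) : in_piece k p -> v k \in piece p.
Proof.
case: p => i j; rewrite /in_piece /piece /=; case: (leqP i j) => ij k_ij;
  rewrite ?mem_rev; apply: map_f; rewrite mem_iota; lia.
Qed.

Lemma size_piece (p : nat * nat) :
  size (piece p) = (maxn p.1 p.2 - minn p.1 p.2).+1.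
Proof.
case: p => i j; rewrite /piece /=; case: (leqP i j) => ij;
  rewrite ?size_rev size_map size_iota; lia.
Qed.

Lemma uniq_vs : uniq (map v (iota 0 m.+1)).
Proof.
rewrite map_inj_in_uniq ?iota_uniq // => i j; rewrite !mem_iota => ? ?.
by apply: v_inj; lia.
Qed.

Lemma mem_vs (u : T) : u \in map v (iota 0 m.+1).
Proof. by have [i i_m <-] := v_surj u; apply: map_f; rewrite mem_iota; lia. Qed.

(** Covering all indices with total length [m.+1] forces the pieces to be disjoint; both
    requirements are linear arithmetic in the endpoints. *)
Lemma hamiltonian_pieces (q : seq (nat * nat)) :
  all (fun p => (p.1 <= m) && (p.2 <= m)) q ->
  cycle (fun p p' => e (v p.2) (v p'.1)) q ->
  sumn [seq (maxn p.1 p.2 - minn p.1 p.2).+1 | p <- q] = m.+1 ->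
  (forall k, k <= m -> has (in_piece k) q) ->
  hamiltonian e.
Proof.
case: q => // p q q_m q_cycle q_size q_cover.
have trail_q : path (fun p p' => e (v p.2) (v p'.1)) p q ->
    trail (flatten (map piece (p :: q))) (v p.1) (v (last p q).2).
  elim: q p q_m {q_size q_cover q_cycle} => [|p' q IHq] p.
    by rewrite /= cats0 andbT => /andP[? ?] _; apply: trail_piece.
  move=> /= /andP[/andP[? ?] q_m] /andP[pp' p'q].
  by apply: (trail_cat _ pp' (IHq p' q_m p'q)); apply: trail_piece.
move: q_cycle; rewrite /= rcons_path => /andP[/trail_q {}trail_q q_close].
set c := flatten _ in trail_q.
have c_size : size c = m.+1.
  rewrite -q_size size_flatten /shape -map_comp; congr sumn.
  by apply: eq_map => p'; apply: size_piece.
have c_mem u : u \in c.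
  have [k k_m <-] := v_surj u; have /hasP[p' p'q k_p'] := q_cover k k_m.
  by apply/flattenP; exists (piece p'); [apply: map_f | apply: mem_piece].
exists c; split=> //; first by rewrite c_size; lia.
apply/andP; split; last first.
  apply: leq_size_uniq uniq_vs _ _; first by move=> u _; apply: c_mem.
  by rewrite c_size size_map size_iota.
by case: trail_q => r [-> cr r_last]; rewrite /= rcons_path cr r_last.
Qed.

Hypothesis nonham : ~ hamiltonian e.

(** The bound [i <= m] makes indices such as [m.+1] count as nonadjacent, since [v] is unconstrained
    there. *)
Definition adjx (i : nat) : bool := (i <= m) && e (v 0) (v i).
Definition adjy (i : nat) : bool := (i <= m) && e (v m) (v i).

Lemma adjx_le (i : nat) : adjx i -> i <= m. Proof. by case/andP. Qed.

Ltac drop_edges := repeat match goal with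
  | H : is_true (e _ _) |- _ => clear H
  | H : is_true (adjx _) |- _ => clear H
  | H : is_true (adjy _) |- _ => clear H
  | H : is_true (~~ adjx _) |- _ => clear H
  | H : is_true (~~ adjy _) |- _ => clear H
  end.

(* [q] lists stretches of the path in the order in which the new cycle
   traverses them. *)
Ltac reroute q :=
  exfalso; apply: nonham;
  apply: (@hamiltonian_pieces q); rewrite /in_piece /=;
  [drop_edges; lia | rewrite ?andbT; repeat (apply/andP; split);
         first [by [] | by rewrite e_sym]
  | drop_edges; lia | move=> ?; drop_edges; lia].

(** Ore's exchange. *)
Lemma no_x_next_y (i : nat) : adjy i -> adjx i.+1 -> False.
Proof. by move=> /andP[? ?] /andP[? ?]; reroute [:: (0, i); (m, i.+1)]. Qed.

Lemma crossing_right (k j : nat) :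
  k < j <= m -> e (v k) (v j) -> adjx k.+1 -> adjy j.-1 -> False.
Proof.
move=> kj ekj ak bj; have [jk|jk] := eqVneq j k.+1.
  by apply: (no_x_next_y bj); rewrite jk.
move: ak bj => /andP[? ?] /andP[? ?].
by reroute [:: (0, k); (j, m); (j.-1, k.+1)].
Qed.

Lemma crossing_left_y (k j : nat) :
  k < j -> e (v k) (v j) -> adjy k.+1 -> adjx j.+1 -> False.
Proof.
by move=> ? ? /andP[? ?] /andP[? ?]; reroute [:: (k.+1, j); (k, 0); (j.+1, m)].
Qed.

Lemma crossing_left_x (k j : nat) :
  0 < k < j -> j <= m -> e (v k) (v j) -> adjy k.-1 -> adjx j.-1 -> False.
Proof.
by move=> ? ? ? /andP[? ?] /andP[? ?]; reroute [:: (0, k.-1); (m, j); (k, j.-1)].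
Qed.

(* For such [j] the cycle [v 0 .. v j.-1, v m .. v j.+1, v 0] misses only [v j]. *)
Definition bypassed (j : nat) : bool := [&& 0 < j, adjy j.-1 & adjx j.+1].

(** The two chords replace the path edge between [v k] and [v k.+1]; the cycle closes through the
    edges from [v m] to [v j'.-1] and from [v 0] to [v j.+1], in either order of [j] and [j']. *)
Lemma bypassed_left_pair (j j' k : nat) : bypassed j -> bypassed j' ->
  k.+1 < j -> k.+1 < j' -> e (v j) (v k) -> e (v j') (v k.+1) -> False.
Proof.
move=> /and3P[j_gt0 bj aj] /and3P[j'_gt0 bj' aj'] kj kj' ejk ej'k.
have j'm := adjx_le aj'; have [jj'|jj'] := ltnP j j'; last first.
  move: bj' aj => /andP[? ?] /andP[? ?].
  by reroute [:: (0, k); (j, j'); (k.+1, j'.-1); (m, j.+1)].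
have [?|?] := eqVneq j' j.+1.
  by apply: (no_x_next_y bj'); subst j'.
move: bj' aj => /andP[? ?] /andP[? ?].
by reroute [:: (0, k); (j, k.+1); (j', m); (j'.-1, j.+1)].
Qed.

Lemma bypassed_right_pair (j j' k : nat) : bypassed j -> bypassed j' ->
  j < k <= m -> j' < k -> e (v j) (v k.+1) -> e (v j') (v k) -> k < m -> False.
Proof.
move=> /and3P[j_gt0 bj aj] /and3P[j'_gt0 bj' aj'] kj kj' ejk ej'k km.
have [jj'|jj'] := ltnP j' j.
  have [?|?] := eqVneq j j'.+1.
    by apply: (no_x_next_y bj); subst j.
  move: bj aj' => /andP[? ?] /andP[? ?].
  by reroute [:: (m, k.+1); (j, k); (j', 0); (j'.+1, j.-1)].
move: bj aj' => /andP[? ?] /andP[? ?].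
by reroute [:: (m, k.+1); (j, j'); (k, j'.+1); (0, j.-1)].
Qed.

Definition neither (i : nat) : bool := [&& 0 < i < m, ~~ adjx i & ~~ adjy i].

(** The indices missed both by the neighbours of x and by the successors of the neighbours of y. *)
Definition gap (i : nat) : bool := [&& 0 < i <= m, ~~ adjx i & ~~ adjy i.-1].

(** A bypassed index belongs to both classes: x adjacent to [v k.+1] clashes with y adjacent to
    [v j.-1], and y adjacent to [v k.+1] with x adjacent to [v j.+1]. *)
Lemma bypassed_nbr_left (j k : nat) : bypassed j -> k < j ->
  e (v j) (v k) -> neither k.+1.
Proof.
move=> /and3P[j_gt0 bj aj] kj; rewrite e_sym => ekj; have jm := adjx_le aj.
rewrite /neither; apply/and3P; split; first by lia.
  by apply/negP=> ak; apply: (crossing_right _ ekj ak bj); lia.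
by apply/negP=> bk; apply: (crossing_left_y kj ekj bk aj).
Qed.

Lemma bypassed_nbr_right (j k : nat) : bypassed j -> j < k <= m ->
  e (v j) (v k) -> neither k.-1.
Proof.
move=> /and3P[j_gt0 bj aj] kj ejk; have jm := adjx_le aj.
rewrite /neither; apply/and3P; split; first by lia.
  by apply/negP=> ak; apply: (crossing_left_x _ _ ejk bj ak); lia.
by apply/negP=> bk; apply: (crossing_right _ ejk aj bk); lia.
Qed.

Lemma neitherP (i : nat) :
  neither i -> [|| bypassed i, gap i | gap i.+1].
Proof.
move=> /and3P[im ai bi]; rewrite /bypassed /gap ai bi /=.
by move: im; case: (adjy i.-1); case: (adjx i.+1) => /=; lia.
Qed.

(** The chord from [v g] to [v c.+1] makes [v c] behave like a bypassed vertex, although [v c.-1]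
    need not be adjacent to y. *)
Lemma second_of_run (c g : nat) : 0 < c -> ~~ adjx c -> adjx c.+1 ->
  0 < g < c -> adjy g.-1 -> e (v g) (v c.+1) -> forall k, k <= m ->
  e (v c) (v k) ->
  (k < c -> neither k.+1) /\ (c < k -> neither k.-1).
Proof.
move=> c_gt0 nac ac gc bg egc k km eck; have cm := adjx_le ac.
have nbc : ~~ adjy c by apply/negP=> bc; apply: no_x_next_y bc ac.
have Hx := ac; have Hy := bg; case/andP: Hx => _ ?; case/andP: Hy => _ ?.
split=> [kc|ck]; rewrite /neither; apply/and3P; split; try by lia.
- apply/negP=> ak; have [?|?] := eqVneq k.+1 c; first by subst c; rewrite ak in nac.
  case/andP: (ak) => ? ?; have [?|?] := ltnP k g.
    have [?|?] := eqVneq k.+1 g.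
      by apply: (no_x_next_y bg); subst g.
    by reroute [:: (0, k); (c, g); (c.+1, m); (g.-1, k.+1)].
  by reroute [:: (0, g.-1); (m, c.+1); (g, k); (c, k.+1)].
- by apply/negP=> bk; apply: (@crossing_left_y k c); rewrite // e_sym.
- have [->//|?] := eqVneq k.-1 c; apply/negP=> ak; case/andP: (ak) => ? ?.
  by reroute [:: (0, g.-1); (m, k); (c, g); (c.+1, k.-1)].
- by apply/negP=> bk; apply: (@crossing_right c k); rewrite ?ck.
Qed.

(** * Counting along the path *)

Definition cnt (P : pred nat) : nat := count P (iota 0 m.+1).

Lemma cntE (P : pred nat) : cnt P = \sum_(i <- iota 0 m.+1) P i.
Proof. by rewrite /cnt -sum1_count big_mkcond. Qed.

Lemma cnt_inj (P Q : pred nat) (f : nat -> nat) :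
  (forall k, k <= m -> P k -> (f k <= m) && Q (f k)) ->
  (forall k k', k < k' <= m -> P k -> P k' -> f k <> f k') ->
  cnt P <= cnt Q.
Proof.
move=> PQ f_inj; rewrite /cnt -!size_filter -(size_map f).
apply: uniq_leq_size => [|j /mapP[k]].
  rewrite map_inj_in_uniq ?filter_uniq ?iota_uniq // => k k'.
  rewrite !mem_filter !mem_iota => /andP[Pk k_m] /andP[Pk' k'_m] ff.
  case: (ltngtP k k') => // lt.
    by case: (f_inj k k' _ Pk Pk'); lia.
  by case: (f_inj k' k _ Pk' Pk); lia.
rewrite !mem_filter !mem_iota => /andP[Pk k_m] ->.
have km : k <= m by lia.
by have /andP[fk_m ->] := PQ k km Pk; lia.
Qed.

Lemma card_cnt (P : pred T) : #|[set u | P u]| = cnt (fun i => P (v i)).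
Proof.
rewrite cardsE cardE size_filter -enumT /cnt -(count_map v P).
apply/permP/uniq_perm; rewrite ?enum_uniq ?uniq_vs // => u.
by rewrite mem_enum mem_vs.
Qed.

Lemma degree_cnt (j : nat) : degree e (v j) = cnt (fun k => e (v j) (v k)).
Proof. exact: card_cnt. Qed.

Definition pos (u : T) : nat := index u (map v (iota 0 m.+1)).

Lemma pos_le (u : T) : pos u <= m.
Proof. by have := mem_vs u; rewrite -index_mem size_map size_iota. Qed.

Lemma v_pos (u : T) : v (pos u) = u.
Proof.
rewrite -[RHS](nth_index (v 0) (mem_vs u)) (nth_map 0) ?size_iota ?ltnS ?pos_le //.
by rewrite nth_iota ?ltnS ?pos_le.
Qed.

Lemma pos_v (i : nat) : i <= m -> pos (v i) = i.
Proof. by move=> im; apply: v_inj; rewrite ?pos_le ?v_pos. Qed.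

Lemma card_pos (P : pred nat) : #|[set u | P (pos u)]| = cnt P.
Proof.
rewrite card_cnt; apply: eq_in_count => i; rewrite mem_iota => im.
by rewrite pos_v.
Qed.

Lemma leq_sum_iota (F G : nat -> nat) : (forall i, i <= m -> F i <= G i) ->
  \sum_(i <- iota 0 m.+1) F i <= \sum_(i <- iota 0 m.+1) G i.
Proof.
move=> FG; rewrite big_seq [X in _ <= X]big_seq; apply: leq_sum => i.
by rewrite mem_iota => im; apply: FG; lia.
Qed.

Lemma cnt_le_sum2 (P Q R : pred nat) :
  (forall i, i <= m -> P i <= Q i + R i) -> cnt P <= cnt Q + cnt R.
Proof. by move=> ?; rewrite !cntE -big_split; apply: leq_sum_iota. Qed.

Lemma cnt_sum2_le (P Q R S : pred nat) :
  (forall i, i <= m -> P i + Q i <= R i + S i) ->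
  cnt P + cnt Q <= cnt R + cnt S.
Proof. by move=> ?; rewrite !cntE -!big_split; apply: leq_sum_iota. Qed.

Lemma cnt_sum3_le (P Q R : pred nat) :
  (forall i, i <= m -> P i + Q i + R i <= 1) -> cnt P + cnt Q + cnt R <= m.+1.
Proof.
move=> ?; rewrite -[X in _ <= X](size_iota 0) -sum1_size !cntE -!big_split.
exact: leq_sum_iota.
Qed.

Lemma cnt_or0 (P : pred nat) :
  P 0 = false -> cnt (fun i => P i || (i == 0)) = (cnt P).+1.
Proof.
move=> P0; rewrite /cnt /= P0 /=; congr _.+1; apply: eq_in_count => -[|i].
  by rewrite mem_iota.
by rewrite orbF.
Qed.

Lemma cnt_pred1 (j : nat) : cnt (pred1 j) <= 1.
Proof. by rewrite /cnt count_uniq_mem ?iota_uniq //; case: (_ \in _). Qed.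

Hypothesis e_irr : irreflexive e.

Lemma adjx0 : adjx 0 = false. Proof. by rewrite /adjx e_irr andbF. Qed.
Lemma adjy_m : adjy m = false. Proof. by rewrite /adjy e_irr andbF. Qed.
Lemma adjx1 : adjx 1. Proof. by rewrite /adjx v_path; lia. Qed.
Lemma adjy_pred_m : adjy m.-1.
Proof.
rewrite /adjy leq_pred e_sym; have := @v_path m.-1; rewrite prednK; last by lia.
by apply; lia.
Qed.

Lemma degree_x : degree e (v 0) = cnt adjx.
Proof.
rewrite degree_cnt; apply: eq_in_count => i; rewrite mem_iota /adjx => im.
by have -> : i <= m by lia.
Qed.

Lemma degree_y : degree e (v m) = cnt adjy.
Proof.
rewrite degree_cnt; apply: eq_in_count => i; rewrite mem_iota /adjy => im.
by have -> : i <= m by lia.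
Qed.

Definition succ_y (i : nat) : bool := (0 < i) && adjy i.-1.

Lemma cnt_succ_y : cnt adjy <= cnt succ_y.
Proof.
apply: (cnt_inj (f := succn)) => [k km bk | k k' kk' _ _]; last by lia.
rewrite /succ_y /= bk andbT ltn_neqAle km andbT.
by apply: contraTneq bk => ->; rewrite adjy_m.
Qed.

Lemma cnt_pred_x : cnt adjx <= cnt (fun i => adjx i.+1).
Proof.
apply: (cnt_inj (f := predn)) => [[|k] km|k k' kk']; rewrite ?adjx0 // => ak.
  by rewrite /= ak andbT; lia.
by move=> _; case: k kk' ak => [|k]; rewrite ?adjx0 //; lia.
Qed.

Lemma cnt_pred_x_le : cnt (fun i => adjx i.+1) <= cnt adjx.
Proof.
apply: (cnt_inj (f := succn)) => [k km ak | k k' kk' _ _]; last by lia.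
by rewrite ak (adjx_le ak).
Qed.

Lemma succ_yF (i : nat) : adjx i -> succ_y i = false.
Proof.
case: i => // i ai; apply/negP=> /andP[_ bi]; exact: no_x_next_y bi ai.
Qed.

Variable t : nat.
Hypothesis e_tough : tough_col e t.
Hypothesis t_ge4 : 4 <= t.
Hypothesis degree_sum : m.+1 <= degree e (v 0) + degree e (v m) + t.

(** Gaps, neighbours of x and successors of neighbours of y are pairwise disjoint; index 0 lies in
    none of them, which makes the bound strict. *)
Lemma cnt_gap : cnt gap < t.
Proof.
have : cnt (fun i => gap i || (i == 0)) + cnt adjx + cnt succ_y <= m.+1.
  apply: cnt_sum3_le => i im; have := @succ_yF i; rewrite /gap /succ_y.
  case: i im => [|i] im; first by rewrite adjx0.
  rewrite im /=; case: (adjx i.+1) => //= [/(_ isT) -> //|]; case: (adjy i) => //.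
rewrite cnt_or0 //.
have := cnt_succ_y; have := degree_sum; rewrite degree_x degree_y; lia.
Qed.

(** An edge to a later [j'] would leave [v j.+1] adjacent to neither end, but it is adjacent to
    x. *)
Lemma bypassed_indep (j j' : nat) :
  bypassed j -> bypassed j' -> e (v j) (v j') -> False.
Proof.
wlog jj' : j j' / j <= j'.
  move=> IH; case: (leqP j j') => [|/ltnW] le; first exact: IH.
  by move=> ? ? ?; apply: (IH j' j); rewrite // e_sym.
move=> Bj Bj' ejj'; have [jj'E|ltjj'] := eqVneq j j'.
  by rewrite jj'E e_irr in ejj'.
have := @bypassed_nbr_left j' j Bj'; rewrite e_sym => /(_ _ ejj') /and3P[].
  by lia.
by move=> _ /negP[]; case/and3P: Bj.
Qed.

Definition charge (i : nat) : bool := bypassed i || gap i.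

(* By [bypassed_left_pair] no two consecutive vertices of [P] are charged to the
   same gap. *)
Lemma cnt_left (P : pred nat) (d : nat) :
  (forall k, P k -> exists2 j, bypassed j & (k < j <= d) && e (v j) (v k)) ->
  cnt P <= cnt (fun i => charge i && (i <= d)).
Proof.
move=> PB; apply: (cnt_inj (f := fun k => if charge k.+1 then k.+1 else k.+2)).
  move=> k km /PB[j Bj /andP[kj ejk]].
  case/andP: kj => kj jd; have := neitherP (bypassed_nbr_left Bj kj ejk).
  case/and3P: (Bj) => _ _ aj; have jm := adjx_le aj.
  rewrite orbA -/(charge _); case: ifP => [-> _ | _ /= gk2]; first by lia.
  (* The charged index must not pass [j], and [j.+1] is no gap. *)
  have k2j : k.+2 != j.+1 by apply: contraTneq gk2 => ->; rewrite /gap aj !andbF.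
  by rewrite /charge gk2 orbT; lia.
move=> k k' kk' /PB[j Bj /andP[kj ejk]] /PB[j' Bj' /andP[kj' ej'k']].
have [k'E|] := eqVneq k' k.+1; last by case: ifP; case: ifP; lia.
subst k'; case: ifP => ck1; case: ifP => ck2; try lia; move=> _.
apply: (bypassed_left_pair Bj Bj' _ _ ejk ej'k'); last by lia.
have : j != k.+1 by apply: contraFneq ck1 => <-; rewrite /charge Bj.
by lia.
Qed.

Lemma cnt_right (P : pred nat) (d : nat) :
  (forall k, P k -> exists2 j, bypassed j & [&& d <= j, j < k & e (v j) (v k)]) ->
  cnt P <= cnt (fun i => charge i && (d <= i)).
Proof.
move=> PB; apply: (cnt_inj (f := fun k => if charge k.-1 then k.-1 else k)).
  move=> k km /PB[j Bj /and3P[dj jk ejk]].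
  have jkm : j < k <= m by rewrite jk.
  have := neitherP (bypassed_nbr_right Bj jkm ejk).
  rewrite prednK; last by lia.
  rewrite orbA -/(charge _); case: ifP => [-> _ | _ /= gk]; first by lia.
  by rewrite /charge gk orbT; lia.
move=> k k' kk' /PB[j' Bj' /and3P[_ jk ej'k]] /PB[j Bj /and3P[_ jk' ejk']].
have [k'E|] := eqVneq k' k.+1; last by case: ifP; case: ifP; lia.
subst k'; rewrite /=; case: ifP => ck1; case: ifP => ck2; try lia; move=> _.
have jk0 : j != k.
  by apply/eqP=> jE; apply: (bypassed_indep Bj' Bj); rewrite jE.
by apply: (bypassed_right_pair Bj Bj' _ _ ejk' ej'k); lia.
Qed.

(** Only [j] itself can be counted on both sides, whence the [+ 1]. *)
Lemma degree_split (j : nat) (P : pred nat) : j <= m ->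
  cnt (fun k => (k < j) && e (v j) (v k)) <= cnt (fun i => P i && (i <= j)) ->
  cnt (fun k => (j < k) && e (v j) (v k)) <= cnt (fun i => P i && (j <= i)) ->
  degree e (v j) <= cnt P + 1.
Proof.
move=> jm le_l le_r; rewrite degree_cnt.
have : cnt (fun k => e (v j) (v k)) <=
    cnt (fun k => (k < j) && e (v j) (v k)) +
    cnt (fun k => (j < k) && e (v j) (v k)).
  apply: cnt_le_sum2 => k _.
  by case: (ltngtP k j) => [_|_|->] /=; rewrite ?e_irr //; lia.
have : cnt (fun i => P i && (i <= j)) + cnt (fun i => P i && (j <= i)) <=
    cnt P + cnt (pred1 j).
  by apply: cnt_sum2_le => k _ /=; case: (P k); case: (ltngtP k j).
by have := cnt_pred1 j; lia.
Qed.

Lemma degree_nonneighbour_x (j : nat) :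
  0 < j <= m -> ~~ adjx j -> 2 * t <= degree e (v j).
Proof.
move=> /andP[j0 jm] naj; apply: (tough_degree e_tough (y := v 0)) => //.
  by apply: contraTneq j0 => /v_inj ->.
by move: naj; rewrite /adjx jm e_sym.
Qed.

(* Set B = #bypassed and C = #gaps < t. A bypassed vertex has degree at most
   B + C + 1, so B >= t; the bypassed vertices are independent with at most
   2 (B + C) neighbours, so t B <= 2 (B + C). These contradict t >= 4. *)
Lemma no_bypassed (j : nat) : ~~ bypassed j.
Proof.
apply/negP=> Bj; case/and3P: (Bj) => j0 bj aj; have jm := adjx_le aj.
have charge_le : cnt charge <= cnt bypassed + cnt gap.
  by apply: cnt_le_sum2 => i _; rewrite /charge; case: (bypassed i); case: (gap i).
have B_ge : t <= cnt bypassed.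
  have : degree e (v j) <= cnt charge + 1.
    apply: degree_split => //; first by lia.
      by apply: cnt_left => k /andP[kj ejk]; exists j; rewrite ?kj ?ejk ?leqnn.
    by apply: cnt_right => k /andP[kj ejk]; exists j; rewrite ?kj ?ejk ?leqnn.
  have : 2 * t <= degree e (v j).
    apply: degree_nonneighbour_x; first by lia.
    by apply/negP=> aj'; apply: (@no_x_next_y j.-1); rewrite // prednK.
  by have := cnt_gap; lia.
(* [L] and [R] collect the vertices with a bypassed neighbour to their right and to their left. *)
pose L k :=
  has (fun j => bypassed j && ((k < j <= m) && e (v j) (v k))) (iota 0 m.+1).
pose R k :=
  has (fun j => bypassed j && [&& 0 <= j, j < k & e (v j) (v k)]) (iota 0 m.+1).
have L_le : cnt L <= cnt charge.
  apply: leq_trans (sub_count _ _); first apply: (@cnt_left _ m).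
    by move=> k /hasP[i _ /andP[Bi ?]]; exists i.
  by move=> i /= /andP[].
have R_le : cnt R <= cnt charge.
  apply: leq_trans (sub_count _ _); first apply: (@cnt_right _ 0).
    by move=> k /hasP[i _ /andP[Bi ?]]; exists i.
  by move=> i /= /andP[].
have := @tough_indep _ _ _ e_tough [set u | bypassed (pos u)]
  ([set u | L (pos u)] :|: [set u | R (pos u)]).
rewrite card_pos => tI.
have : t * cnt bypassed <= cnt L + cnt R.
  rewrite -!card_pos; apply: leq_trans (leq_card_setU _ _).1.
  rewrite card_pos; apply: tI => //; first by lia.
    rewrite disjoints_subset; apply/subsetP=> u; rewrite !inE => Bu.
    by apply/negP=> /orP[] /hasP[i _ /andP[Bi]];
      [move=> /andP[_] | move=> /and3P[_ _]]; exact: bypassed_indep.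
  move=> u w; rewrite !inE => Bu euw.
  have [lt|gt|eq] := ltngtP (pos u) (pos w).
  - apply/orP; right; apply/hasP; exists (pos u).
      by rewrite mem_iota; have := pos_le u; lia.
    by rewrite Bu lt !v_pos.
  - apply/orP; left; apply/hasP; exists (pos u).
      by rewrite mem_iota; have := pos_le u; lia.
    by rewrite Bu gt pos_le !v_pos.
  - by move: euw; rewrite -[u]v_pos -[w]v_pos eq e_irr.
(* The chain [(t - 2) * t <= (t - 2) * cnt bypassed <= 2 * cnt gap < 2 * t] would give [t < 4]. *)
have : (t - 2) * t <= (t - 2) * cnt bypassed by rewrite leq_mul2l B_ge orbT.
have := cnt_gap; nia.
Qed.

(* Otherwise every neighbour of [v c] is next to a vertex adjacent to neither
   end; there are at most 2 (t - 1) of those, while deg (v c) >= 2 t. *)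
Lemma no_edge_to_second (c g : nat) : 0 < c -> ~~ adjx c -> adjx c.+1 ->
  0 < g < c -> adjy g.-1 -> e (v g) (v c.+1) -> False.
Proof.
move=> c0 nac ac gc bg egc; have cm := adjx_le ac.
have nbr_neither := second_of_run c0 nac ac gc bg egc.
have : degree e (v c) <= cnt neither + 1.
  apply: degree_split; first by lia.
    apply: (cnt_inj (f := succn)) => [k km /andP[kc eck] | k k' kk' _ _];
      last by lia.
    by rewrite (nbr_neither k km eck).1 //; lia.
  apply: (cnt_inj (f := predn)) => [k km /andP[kc eck] | k k' kk' /andP[]];
    last by lia.
  by rewrite (nbr_neither k km eck).2 //; lia.
have : 2 * t <= degree e (v c) by apply: degree_nonneighbour_x => //; lia.
have : cnt neither <= cnt gap + cnt (fun i => gap i.+1).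
  apply: cnt_le_sum2 => i _; have := @neitherP i.
  by case: (neither i) => // /(_ isT); rewrite (negbTE (no_bypassed i)) /=;
    case: (gap i); case: (gap i.+1).
have : cnt (fun i => gap i.+1) <= cnt gap.
  apply: (cnt_inj (f := succn)) => [k km gk | k k' kk' _ _]; last by lia.
  by rewrite gk; case/and3P: gk; lia.
by have := cnt_gap; lia.
Qed.

(** * The cut separating the ends of the path *)

Definition unlabelled (i : nat) : bool := ~~ adjx i.+1 && ~~ succ_y i.
(** Index 0 also begins a run, but x must stay outside the cut. *)
Definition run_start (i : nat) : bool := [&& 0 < i, adjx i.+1 & ~~ adjx i].

Lemma pred_x_succ_y (i : nat) : adjx i.+1 -> succ_y i -> False.
Proof.
move=> ai /andP[i0 bi]; have := no_bypassed i.
by rewrite /bypassed i0 ai bi.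
Qed.

(** The count resembles that of the gaps, but 0 is now a predecessor of a neighbour of x, so no
    index is spare. *)
Lemma cnt_unlabelled : cnt unlabelled <= t.
Proof.
have : cnt unlabelled + cnt (fun i => adjx i.+1) + cnt succ_y <= m.+1.
  apply: cnt_sum3_le => i im; have := @pred_x_succ_y i; rewrite /unlabelled.
  by case: (adjx i.+1); case: (succ_y i) => // /(_ isT isT).
have := cnt_pred_x; have := cnt_succ_y; have := degree_sum.
by rewrite degree_x degree_y; lia.
Qed.

(** The index just after a run is a neighbour of x, hence no successor of a neighbour of y, hence
    unlabelled. So each run has its own unlabelled index, and the run beginning at 0 makes the
    inequality strict. *)
Lemma cnt_run_start : cnt run_start < cnt unlabelled.
Proof.
pose both i := adjx i && adjx i.+1; rewrite -cnt_or0 //.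
have : cnt (fun i => run_start i || (i == 0)) + cnt both <=
    cnt (fun i => adjx i.+1) + cnt pred0.
  apply: cnt_sum2_le => -[|i] _; rewrite /run_start /both /= ?adjx0 ?adjx1 // orbF.
  by case: (adjx i.+1); case: (adjx i.+2).
have -> : cnt pred0 = 0 by rewrite /cnt count_pred0.
have : cnt adjx <= cnt both + cnt unlabelled.
  apply: cnt_le_sum2 => i _; have := @succ_yF i; rewrite /both /unlabelled.
  by case: (adjx i) => // ->; case: (adjx i.+1).
by have := cnt_pred_x_le; lia.
Qed.

(* The predecessors of the neighbours of [x] and the successors of the neighbours
   of [y] cover all but the at most t unlabelled vertices. The only edges between
   the two classes end at the first vertex of a run of the former, and there are
   fewer such run starts than unlabelled vertices. So fewer than 2 t vertices
   separate [x] from [y]. *)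
Lemma nonhamiltonian_absurd : False.
Proof.
pose S := [set u | unlabelled (pos u) || run_start (pos u)].
have m0 : pos (v 0) = 0 by rewrite pos_v.
have mm : pos (v m) = m by rewrite pos_v.
have a_m1 : adjx m.+1 = false by apply: contraFF (ltnn m); apply: adjx_le.
have yF i : adjx i.+1 -> succ_y i = false.
  by move=> ai; apply/negP; apply: pred_x_succ_y.
have labelled i : ~~ unlabelled i -> adjx i.+1 || succ_y i.
  by rewrite /unlabelled; case: (adjx i.+1); case: (succ_y i).
have no_edge i j : i <= m -> j <= m -> adjx i.+1 -> ~~ run_start i -> succ_y j ->
    e (v i) (v j) -> False.
  move=> im jm ai nri /andP[j0 bj] eij.
  have [lt|gt|eq] := ltngtP i j.
  - by apply: (crossing_right _ eij ai bj); rewrite lt.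
  (* As [i] starts no run, [v i] is adjacent to x; either [v i.-1] is too, or [i] is second in the
     run starting at [i.-1]. *)
  - move: nri; rewrite /run_start ai /= negb_and negbK; case/orP; first by lia.
    move=> aii; have i0 : 0 < i by lia.
    have iE : i.-1.+1 = i by rewrite prednK.
    rewrite e_sym in eij; have [api|napi] := boolP (adjx i.-1).
      by apply: (crossing_left_x _ _ eij bj api); lia.
    have jneq : j != i.-1.
      by apply/eqP=> jE; apply: (@pred_x_succ_y j); rewrite /succ_y ?j0 // jE iE.
    have i1 : 0 < i.-1 by lia.
    by apply: (@no_edge_to_second i.-1 j); rewrite ?iE //; lia.
  - by apply: (@pred_x_succ_y j); rewrite -?eq // /succ_y eq j0.
have : 2 * t <= #|S|.
  apply: (tough_separator e_tough (A := [set u | adjx (pos u).+1])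
    (x := v 0) (y := v m)).
  - by rewrite inE m0 /unlabelled adjx1.
  - by rewrite inE m0 adjx1.
  - by rewrite inE mm /unlabelled /run_start a_m1 /succ_y adjy_pred_m /= andbF; lia.
  - by rewrite inE mm a_m1.
  move=> u w; rewrite !inE !negb_or.
  move=> /andP[/labelled mu ru] /andP[/labelled mw rw].
  move=> euw; case: (boolP (adjx (pos u).+1)) mu => [au _|_ /= yu].
    case: (boolP (adjx (pos w).+1)) mw => //= _ yw.
    by case: (@no_edge (pos u) (pos w)); rewrite ?pos_le ?v_pos.
  case: (boolP (adjx (pos w).+1)) mw => //= aw _.
  by case: (@no_edge (pos w) (pos u)); rewrite ?pos_le ?v_pos // e_sym.
have : #|S| <= cnt unlabelled + cnt run_start.
  rewrite (card_pos (fun i => unlabelled i || run_start i)).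
  by apply: cnt_le_sum2 => i _; case: (unlabelled i); case: (run_start i).
have := cnt_run_start; have := cnt_unlabelled; lia.
Qed.
End HamiltonianPath.

(** * The closure argument *)

(** A Hamiltonian cycle is a tuple of length [#|T|], so the search is finite. *)
Lemma hamiltonian_dec (T : finType) (e : rel T) :
  hamiltonian e \/ ~ hamiltonian e.
Proof.
pose P (c : #|T|.-tuple T) := [&& 3 <= size c, ucycleb e c & [forall x, x \in c]].
have [/existsP[c /and3P[c3 c_cycle /forallP cT]]|noc] := boolP [exists c, P c].
  by left; exists c.
right=> -[c [c3 c_cycle cT]]; case/negP: noc; apply/existsP.
have c_size : size c == #|T|.
  case/andP: c_cycle => _ /card_uniqP <-; apply/eqP/eq_card => x.
  by rewrite cT.
by exists (Tuple c_size); apply/and3P; split=> //; apply/forallP.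
Qed.

Lemma hamiltonian_complete (T : finType) (e : rel T) :
  3 <= #|T| -> (forall x y, x != y -> e x y) -> hamiltonian e.
Proof.
rewrite cardT => T_ge3 e_compl; have := enum_uniq T.
case enumE: (enum T) => [|x s]; first by rewrite enumE in T_ge3.
move=> xs_uniq; exists (x :: s); split=> [||y].
- by rewrite -enumE.
- apply/andP; split=> //; rewrite /= rcons_path; apply/andP; split.
    have := xs_uniq; rewrite uniq_pairwise => /pairwise_sorted.
    by apply: sub_path => y z; apply: e_compl.
  apply: e_compl; case: s xs_uniq enumE => [_ enumE|z s /andP[xs _] _].
    by rewrite enumE in T_ge3.
  by apply: contraNneq xs => /= xE; rewrite -[X in X \in _]xE mem_last.
- by rewrite -enumE mem_enum.
Qed.

Definition add_edge (T : finType) (e : rel T) (x y : T) : rel T :=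
  [rel u w | [|| e u w, (u == x) && (w == y) | (u == y) && (w == x)]].

(** Rotated to start at [x], the cycle can use the new edge only as its first or last edge, and must
    do so, as [e] is not Hamiltonian. *)
Lemma hamiltonian_add_edge (T : finType) (e : rel T) (x y : T) :
  symmetric e -> x != y -> ~ hamiltonian e -> hamiltonian (add_edge e x y) ->
  exists p, [/\ 2 <= size p, path e x p, last x p = y, uniq (x :: p) &
                forall u, u \in x :: p].
Proof.
move=> e_sym xy nonham [c [c3 /andP[c_cycle c_uniq] cT]].
have [i s cE] := rot_to (cT x).
have s_uniq : uniq (x :: s) by rewrite -cE rot_uniq.
have sT u : u \in x :: s by rewrite -cE mem_rot.
have s_size : 2 <= size s by move: c3; rewrite -(size_rot i) cE.
move: c_cycle; rewrite -(rot_cycle i) cE.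
case: s {cE} s_uniq sT s_size => [|z s] //= /andP[x_s /andP[z_s s_uniq]] sT s_size.
rewrite rcons_path => /and3P[xz zs zx].
have add_off u w : u != x -> w != x -> add_edge e x y u w -> e u w.
  by rewrite /add_edge /= => /negbTE-> /negbTE->; rewrite andbF !orbF.
have {}zs : path e z s.
  apply: (sub_in_path (P := predC1 x)) zs; first by move=> u w; apply: add_off.
  by apply/allP=> u uzs /=; apply: contraNneq x_s => <-.
have zx_neq : z != x by apply: contraNneq x_s => ->; rewrite mem_head.
have last_x : last z s != x by apply: contraNneq x_s => <-; rewrite mem_last.
have z_last : z != last z s.
  case: s z_s s_size {x_s s_uniq sT zs zx last_x} => //= w s z_s _.
  by apply: contraNneq z_s => zE; rewrite [X in X \in _]zE mem_last.
have zs_uniq : uniq [:: x, z & s] by rewrite /= x_s z_s.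
have [zy|zy] := eqVneq z y.
  exists (rev (z :: s)); split=> [|||| u].
  - by rewrite size_rev.
  - rewrite lastI rev_rcons /= rev_path (eq_path (e' := e)) ?zs ?andbT.
      move: zx; rewrite /add_edge /= (negbTE last_x) eqxx -zy (eq_sym (last z s)).
      by rewrite (negbTE z_last) /= !orbF e_sym.
    by move=> u w; rewrite e_sym.
  - by rewrite rev_cons last_rcons.
  - by rewrite /= mem_rev rev_uniq.
  - by have := sT u; rewrite !inE mem_rev inE.
have {}xz : e x z.
  by move: xz; rewrite /add_edge /= (negbTE zy) (negbTE zx_neq) !andbF !orbF.
have [ly|ly] := eqVneq (last z s) y.
  by exists (z :: s); rewrite /= xz zs.
have {}zx : e (last z s) x.
  by move: zx; rewrite /add_edge /= (negbTE ly) (negbTE last_x) /= !orbF.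
case: nonham; exists [:: x, z & s]; split=> //.
by apply/andP; split; rewrite //= rcons_path xz zs.
Qed.

Lemma closure_step (T : finType) (e : rel T) (t : nat) (x y : T) :
  symmetric e -> irreflexive e -> tough_col e t -> 4 <= t -> x != y ->
  #|T| <= degree e x + degree e y + t ->
  hamiltonian (add_edge e x y) -> hamiltonian e.
Proof.
move=> e_sym e_irr e_tough t_ge4 xy xy_deg ham.
have [//|nonham] := hamiltonian_dec e.
have [p [p2 xp last_p p_uniq pT]] := hamiltonian_add_edge e_sym xy nonham ham.
have T_size : #|T| = (size p).+1.
  by apply: etrans (card_uniqP p_uniq); apply: eq_card => u; rewrite pT.
case: (@nonhamiltonian_absurd T e (nth x (x :: p)) (size p) _ _ _ _ _ _ _ t) => //.
- by move=> i j im jm /eqP; rewrite nth_uniq // => /eqP.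
- move=> u; exists (index u (x :: p)); last by rewrite nth_index.
  by have := pT u; rewrite -index_mem.
- by move=> i im; apply: (pathP x xp).
- by rewrite -T_size -[size p]/(size (x :: p)).-1 nth_last /= last_p.
Qed.

Lemma hamiltonian_degree_condition (T : finType) (e : rel T) (t : nat) :
  symmetric e -> irreflexive e -> tough_col e t -> 4 <= t -> 3 <= #|T| ->
  degree_condition e t -> hamiltonian e.
Proof.
(* The number of nonadjacent ordered pairs drops with each added edge. *)
have [k] := ubnP #|[set p : T * T | ~~ e p.1 p.2]|.
elim: k e => // k IHk e non_le e_sym e_irr e_tough t_ge4 T_ge3 e_cond.
pose P (p : T * T) := [&& p.1 != p.2, ~~ e p.1 p.2 &
  #|T| <= degree e p.1 + degree e p.2 + t].
case: (pickP P) => [[x y] /and3P[/= xy exy xy_deg] | noP]; last first.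
  apply: hamiltonian_complete => // x y xy.
  apply: (degree_closed_complete e_sym e_irr _ e_tough e_cond) => //; first by lia.
  move=> u w uw euw; rewrite ltnNge.
  by have := noP (u, w); rewrite /P /= uw euw => /negbT.
have sub_e : subrel e (add_edge e x y) by move=> u w euw; rewrite /add_edge /= euw.
apply: (closure_step e_sym e_irr e_tough t_ge4 xy xy_deg).
apply: IHk => //.
- rewrite -ltnS; apply: leq_trans non_le; rewrite ltnS; apply: proper_card.
  apply/properP; split.
    by apply/subsetP=> p; rewrite !inE; apply: contra; apply: sub_e.
  by exists (x, y); rewrite inE ?negbK // /add_edge /= !eqxx orbT.
- move=> u w; rewrite /add_edge /= e_sym; congr (_ || _).
  by rewrite orbC andbC; congr (_ || _); rewrite andbC.
- move=> u; rewrite /add_edge /= e_irr /=; apply/negP=> /orP[] /andP[/eqP-> /eqP E];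
    by rewrite E eqxx in xy.
- exact: tough_col_sub sub_e e_tough.
- exact: degree_condition_sub sub_e e_cond.
Qed.

(** * From the degree sequence to vertex counts *)

Lemma count_degree_sequence (T : finType) (e : rel T) (d : seq nat) (P : pred nat) :
  degree_sequence e d -> count P d = #|[set x | P (degree e x)]|.
Proof.
move=> [_ [v [v_bij vE]]]; rewrite -sum1_count (big_nth 0) big_mkord sum1dep_card.
rewrite -(card_imset _ (bij_inj v_bij)); apply: eq_card => x.
rewrite !inE; apply/imsetP/idP => [[i] | Px]; first by rewrite inE -vE => Pi ->.
by case: v_bij => w vw wv; exists (w x); rewrite ?inE -?vE wv.
Qed.

Lemma size_degree_sequence (T : finType) (e : rel T) (d : seq nat) :
  degree_sequence e d -> size d = #|T|.
Proof. by case=> _ [v [v_bij _]]; rewrite -(bij_eq_card v_bij) card_ord. Qed.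

Lemma sorted_nth_leq (d : seq nat) (i j : nat) :
  sorted leq d -> i <= j -> j < size d -> nth 0 d i <= nth 0 d j.
Proof.
move=> d_sorted ij jd; apply: (sorted_leq_nth leq_trans leqnn) => //.
by rewrite inE; apply: leq_ltn_trans jd.
Qed.

Lemma degree_condition_of_sequence (T : finType) (e : rel T) (t : nat)
    (d : seq nat) :
  degree_sequence e d ->
  (forall i, 0 < i -> 2 * i < #|T| ->
     dterm d i <= i -> #|T| - i <= dterm d (#|T| - i + t)) ->
  degree_condition e t.
Proof.
move=> d_deg d_cond i i0 iT; have [d_sorted _] := d_deg.
have d_size := size_degree_sequence d_deg.
rewrite -(count_degree_sequence (fun k => k <= i) d_deg).
rewrite -(count_degree_sequence (fun k => #|T| - i <= k) d_deg) => i_le.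
(* Otherwise, by monotonicity, only the first [i.-1] terms can be at most [i]. *)
have /(d_cond i i0 iT) : dterm d i <= i.
  rewrite /dterm leqNgt; apply: contraTN i_le => di; rewrite -ltnNge.
  rewrite -(cat_take_drop i.-1 d) count_cat.
  have -> : count (fun k => k <= i) (drop i.-1 d) = 0.
    apply/eqP; rewrite -leqn0 leqNgt -has_count; apply/hasPn=> k /(nthP 0)[j].
    rewrite size_drop nth_drop => jd <-; rewrite -ltnNge; apply: leq_trans di _.
    by apply: sorted_nth_leq; rewrite ?leq_addr -?ltn_subRL.
  have := count_size (fun k => k <= i) (take i.-1 d).
  by rewrite size_take; case: ifP; lia.
rewrite /dterm; set k := (_ + t).-1 => dk.
(* Beyond the end of [d] the default 0 would give [#|T| <= i]. *)
have [kd|dk'] := ltnP k (size d); last by rewrite nth_default // in dk; lia.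
rewrite -(cat_take_drop k d) count_cat.
(* The tail from position [k] on has [i + 1 - t] terms. *)
suff -> : count (fun k => #|T| - i <= k) (drop k d) = size (drop k d).
  by rewrite size_drop /k; lia.
apply/eqP; rewrite -all_count; apply/(all_nthP 0) => j; rewrite size_drop => jd.
rewrite nth_drop; apply: leq_trans dk _.
by apply: sorted_nth_leq; rewrite ?leq_addr -?ltn_subRL.
Qed.

Theorem theorem3 (t : nat) (t_ge4 : 4 <= t)
    (T : finType) (e : rel T) (e_simple : simple_graph e) (e_tough : tough e t)
    (n : nat) (card_T : #|T| = n) (n_ge3 : 3 <= n)
    (d : seq nat) (d_deg : degree_sequence e d)
    (d_cond : forall i : nat, 0 < i -> 2 * i < n ->
       dterm d i <= i -> n - i <= dterm d (n - i + t)) :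
  hamiltonian e.
Proof.
subst n; case: e_simple => e_sym e_irr.
apply: (hamiltonian_degree_condition e_sym e_irr _ t_ge4 n_ge3).
  exact: tough_tough_col.
exact: degree_condition_of_sequence d_deg d_cond.
Qed.
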